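(* Let $X$ be a reflexive Banach space and let $Z$ be a Hausdorff, locally convex topological vector space. Let $C\subseteq Z$ be a convex, pointed cone with nonempty interior, and let $K$ be a nonempty, convex and closed subset of $X$. Let $D\subseteq K$ be a self segment-dense set in $K$ in the weak topology of $X$, and consider a mapping $f:K\times K\to Z$ satisfying (i) for all $y\in D$, the mapping $x\mapsto f(x,y)$ is $C$-upper semicontinuous on $K$ in the weak topology of $X$; (ii) for all $x\in K$, the mapping $y\mapsto f(x,y)$ is $C$-upper semicontinuous on $K\setminus D$ in the weak topology of $X$; (iii) for all $x\in K$, the mapping $y\mapsto f(x,y)$ is $C$-convex on $D$; (iv) for all $x\in D$, $f(x,x)\notin -\operatorname{int} C$; (v) there exists $r>0$ such that for all $x\in K$ with $\|x\|\le r$ there exists $y_0\in D$ with $\|y_0\|<r$ such that $f(x,y_0)\in -\operatorname{int} C\cup\{0\}$. Then there exists $x_0\in K$ such that $f(x_0,y)\notin -\operatorname{int} C$ for all $y\in K$.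
   Context: All vector spaces are real. $\operatorname{int}$ denotes interior and $\operatorname{cl}$ closure. $-\operatorname{int}C\cup\{0\}$ means $(-\operatorname{int}C)\cup\{0\}$. A set $C\subseteq Z$ is a cone if $tc\in C$ for all $c\in C$ and $t\ge 0$; it is convex if $C+C=C$, and pointed if $C\cap(-C)=\{0\}$. Write $z_1\le z_2$ iff $z_2-z_1\in C$. $C$-upper semicontinuity: a map $g:K\to Z$ is $C$-upper semicontinuous at $x\in K$ if for any neighborhood $V$ of $g(x)$ there exists a neighborhood $U$ of $x$ such that $g(u)\in V-C$ for all $u\in U\cap K$. It is $C$-upper semicontinuous on a subset $S\subseteq K$ if it is so, as a map on $K$, at every point of $S$. ''In the weak topology of $X$'' means that the neighborhoods $U$ are taken in the weak topology of $X$. $C$-convexity: for a (not necessarily convex) set $D$, $g$ is $C$-convex on $D$ if for all $n\in\mathbb N$, $x_1,\dots,x_n\in D$ and $\lambda_1,\dots,\lambda_n\ge 0$ with $\sum_{i=1}^n\lambda_i=1$ such that $\sum_{i=1}^n\lambda_i x_i\in D$, one has $g\left(\sum_{i=1}^n\lambda_i x_i\right)\le\sum_{i=1}^n\lambda_i g(x_i)$. Self segment-dense set: let $U\subseteq V\subseteq X$ with $V$ convex. $U$ is self segment-dense in $V$ if $U$ is dense in $V$ (i.e. $V\subseteq\operatorname{cl}U$) and for all $x,y\in U$ the set $[x,y]\cap U$ is dense in $[x,y]$, where $[x,y]=\{x+t(y-x):t\in[0,1]\}$. ''In the weak topology'' means that closures are taken in the weak topology of $X$.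
   Formalization: Condition (v) additionally requires that some x in K satisfies ‖x‖ ≤ r; otherwise (v) is vacuous and the claim fails, e.g. X = Z = ℝ, C = [0,∞), K = D = [1,∞), f(x,y) = x − y, r = 1/2. *)

(* Defs.v *)
From HB Require Import structures.
From mathcomp Require Import all_boot all_order all_algebra.
From mathcomp Require Import all_classical all_reals all_analysis.

Set Implicit Arguments.
Unset Strict Implicit.
Unset Printing Implicit Defensive.

Import Order.TTheory GRing.Theory Num.Theory.
Import numFieldNormedType.Exports.

Local Open Scope classical_set_scope.
Local Open Scope ring_scope.

Section dual.
Context {R : realType} (X : normedModType R).

Definition continuous_functional : {pred X -> R^o} :=
  fun f => `[< linear f /\ continuous f >].

Record dual := Dual {
  dual_fun :> X -> R^o;
  dual_funP : dual_fun \in continuous_functional }.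

HB.instance Definition _ := [isSub for dual_fun].
HB.instance Definition _ := [Choice of dual by <:].

Lemma continuous_functional_submod : submod_closed continuous_functional.
Proof.
split=> [|a f g /asboolP[lf cf] /asboolP[lg cg]]; apply/asboolP; split.
- by move=> k u v /=; rewrite scaler0 addr0.
- by move=> x; exact: cvg_cst.
- move=> k u v.
  rewrite -[LHS]/(a *: f (k *: u + v) + g (k *: u + v)) lf lg.
  rewrite -[RHS]/(k *: (a *: f u + g u) + (a *: f v + g v)).
  by rewrite !scalerDr !scalerA (mulrC a k) addrACA.
- by move=> x; apply: cvgD; [apply: cvgZr; exact: cf|exact: cg].
Qed.

HB.instance Definition _ := GRing.isSubmodClosed.Build R (X -> R^o)
  continuous_functional continuous_functional_submod.
HB.instance Definition _ := [SubChoice_isSubLmodule of dual by <:].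

Lemma dual_linear (f : dual) : linear f.
Proof. by case/asboolP: (dual_funP f). Qed.

Lemma dual_continuous (f : dual) : continuous f.
Proof. by case/asboolP: (dual_funP f). Qed.

HB.instance Definition _ (f : dual) :=
  GRing.isLinear.Build R X R^o _ f (dual_linear f).

Definition dual_norm (f : dual) : R :=
  sup [set `|f x| | x in [set x | `|x| <= 1]].

Lemma dual_has_sup (f : dual) :
  has_sup [set `|f x| | x in [set x | `|x| <= 1]].
Proof.
split; first by exists `|f 0|, 0 => //=; rewrite normr0.
have /linear_bounded_continuous/bounded_funP/(_ 1)[M fM] := @dual_continuous f.
by exists M => _ [x /= x1 <-]; exact: fM.
Qed.

Lemma dual_norm_ge (f : dual) x : `|x| <= 1 -> `|f x| <= dual_norm f.
Proof.
by move=> x1; apply: (sup_upper_bound (dual_has_sup f)); exists x.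
Qed.

Lemma dual_norm_le (f : dual) (M : R) :
  (forall x, `|x| <= 1 -> `|f x| <= M) -> dual_norm f <= M.
Proof.
move=> fM; apply: ge_sup; first by case: (dual_has_sup f).
by move=> _ [x /= x1 <-]; exact: fM.
Qed.

Lemma dual_norm_ge0 (f : dual) : 0 <= dual_norm f.
Proof. by apply: le_trans (@dual_norm_ge f 0 _); rewrite ?normr0. Qed.

Lemma dual_norm_bound (f : dual) x : `|f x| <= dual_norm f * `|x|.
Proof.
have [->|x0] := eqVneq x 0; first by rewrite linear0 !normr0 mulr0.
have nx : 0 < `|x| by rewrite normr_gt0.
have := @dual_norm_ge f (`|x|^-1 *: x).
rewrite normrZ normfV normr_id mulVf ?gt_eqF// lexx => /(_ isT).
rewrite linearZ /= normrZ normfV normr_id => H.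
by rewrite mulrC -ler_pdivrMl.
Qed.

Lemma dual_ler_normD (f g : dual) :
  dual_norm (f + g) <= dual_norm f + dual_norm g.
Proof.
apply: dual_norm_le => x x1; apply: le_trans (ler_normD (f x) (g x)) _.
by apply: lerD; exact: dual_norm_ge.
Qed.

Lemma dual_normrZ_le (l : R) (f : dual) :
  dual_norm (l *: f) <= `|l| * dual_norm f.
Proof.
apply: dual_norm_le => x x1.
rewrite -[(l *: f) x]/(l * f x) normrM.
by apply: ler_wpM2l => //; exact: dual_norm_ge.
Qed.

Lemma dual_normrZ (l : R) (f : dual) :
  dual_norm (l *: f) = `|l| * dual_norm f.
Proof.
apply/eqP; rewrite eq_le dual_normrZ_le/=.
have [->|l0] := eqVneq l 0; first by rewrite normr0 mul0r dual_norm_ge0.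
rewrite -ler_pdivlMl ?normr_gt0// -normfV.
by apply: le_trans (dual_normrZ_le _ _); rewrite scalerA mulVf// scale1r.
Qed.

Lemma dual_normr0_eq0 (f : dual) : dual_norm f = 0 -> f = 0.
Proof.
move=> f0; apply/val_inj/funext => x /=; apply/normr0_eq0/eqP.
by rewrite eq_le normr_ge0 andbT (le_trans (dual_norm_bound f x))// f0 mul0r.
Qed.

HB.instance Definition _ := Lmodule_isNormed.Build R dual
  dual_ler_normD dual_normrZ dual_normr0_eq0.

End dual.

Section reflexive.
Context {R : realType} (X : normedModType R).

Lemma eval_functional (x : X) :
  (fun f : dual X => f x : R^o) \in @continuous_functional R (dual X).
Proof.
pose ev f : R^o := (f : dual X) x.
have lev : linear ev by [].
pose evl := GRing.isLinear.Build R (dual X) R^o _ ev lev.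
pose L : {linear dual X -> R^o} := HB.pack ev evl.
apply/asboolP; split=> //; apply: (@bounded_linear_continuous _ _ _ L).
apply/bounded_funP => r; exists (r * `|x|) => f fr.
by apply: le_trans (dual_norm_bound f x) _; exact: ler_wpM2r.
Qed.

Definition bidual_embedding (x : X) : dual (dual X) := Dual (eval_functional x).

Definition reflexive_space := range bidual_embedding = [set: dual (dual X)].

End reflexive.

Section weak.
Context {R : realType} (X : normedModType R).

(* X with its weak topology: the coarsest topology making every element of the
   dual of X continuous. *)
Definition weak : Type :=
  sup_topology (fun f : dual X => Topological.class (initial_topology f)).

HB.instance Definition _ := GRing.Lmodule.copy weak X.
HB.instance Definition _ := Topological.copy weak
  (sup_topology (fun f : dual X => Topological.class (initial_topology f))).

End weak.

Section cones.
Context {R : realType} {Z : lmodType R}.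
Implicit Type C : set Z.

Definition cone C := forall c t, C c -> 0 <= t -> C (t *: c).

(* The notion of convexity used for cones; for a nonempty cone it agrees with
   the library's convex_set. *)
Definition cone_convex C := [set c + d | c in C & d in C] = C.

Definition cone_pointed C := C `&` (-%R @` C) = [set 0].

Definition cone_le C (z1 z2 : Z) := C (z2 - z1).

(* The points x and their combination are required to lie in D, which need not
   be convex; n = 0 is excluded by the condition that the weights sum to 1. *)
Definition cone_convex_fun C {E : lmodType R} (D : set E) (g : E -> Z) :=
  forall (n : nat) (x : 'I_n -> E) (l : 'I_n -> R),
    (forall i, D (x i)) -> (forall i, 0 <= l i) -> \sum_i l i = 1 ->
    D (\sum_i l i *: x i) ->
  cone_le C (g (\sum_i l i *: x i)) (\sum_i l i *: g (x i)).

End cones.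

Section cone_upper_semicontinuity.
Context {R : realType} {Z : tvsType R} {T : topologicalType}.

(* A map K -> Z is represented by a total map T -> Z, of which only the values
   on K matter. *)
Definition cone_usc_at (C : set Z) (K : set T) (g : T -> Z) (x : T) :=
  forall V, nbhs (g x) V ->
  exists2 U, nbhs x U &
    forall u, (U `&` K) u -> [set v - c | v in V & c in C] (g u).

Definition cone_usc_on (C : set Z) (K S : set T) (g : T -> Z) :=
  forall x, S x -> cone_usc_at C K g x.

End cone_upper_semicontinuity.

Arguments cone_usc_at {R Z} T C K g x.
Arguments cone_usc_on {R Z} T C K S g.

Section self_segment_dense.
Context {R : realType} {E : preTopologicalLmodType R}.

Definition segment (x y : E) := [set x + t *: (y - x) | t in `[0 : R, 1]].

(* Applied to a convex set V. *)
Definition self_segment_dense (U V : set E) :=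
  [/\ U `<=` V,
      V `<=` closure U &
      forall x y, U x -> U y -> segment x y `<=` closure (segment x y `&` U)].

End self_segment_dense.

Arguments self_segment_dense {R} E U V.

(* Main.v *)
Require Import Defs.
From mathcomp Require Import all_boot boolp.

(* On [Kr = K `&` closed ball of radius r], which is weakly compact by
   reflexivity, let [G y] be the set of [x] with [f x y] outside [- int C].
   For [y] in [D], [G y] is weakly closed by (i), and these sets form a KKM
   family: if a convex combination [p] of points [y_i] of [D] avoided every
   [G y_i], so would a point [u] of [D] close to [p] lying in the convex hull of
   the [y_i], by self segment-density, and (iii) would put [f u u] in [- int C].
   KKM and compactness give [x0] in [Kr] with [f x0 y] outside [- int C] for all
   [y] in [D] of norm at most [r].  The point [y0] of (v) then satisfies
   [f x0 y0 = 0], and convexity along the segment from [y0] to [y], which meets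
   [D] arbitrarily near [y0], extends this to all [y] in [D]; (ii) and density
   extend it to [K].

   KKM is obtained from Scarf's ordinal version of Sperner's lemma, which needs
   no triangulation: the grid points of the simplex are ranked by each
   coordinate, and a fully coloured dominant set has mesh tending to [0]. *)

Set Implicit Arguments.
Unset Strict Implicit.
Unset Printing Implicit Defensive.

(** * Scarf's lemma and the discrete KKM lemma *)

Lemma card_redundant (A B : finType) (f : A -> B) (S : {set A}) :
  #|S| = #|f @: S|.+1 -> #|[set x in S | f @: (S :\ x) == f @: S]| = 2.
Proof.
move=> cS.
have /dinjectivePn[x xS [y /andP[/= yx yS] fxy]] : ~~ dinjectiveb f (mem S).
  apply/dinjectiveP => /card_in_imset /eqP.
  by rewrite cS -addn1 -[X in X == _]addn0 eqn_add2l.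
have fx : f @: (S :\ x) = f @: S.
  apply/eqP; rewrite eqEsubset imsetS ?subsetDl//=.
  apply/subsetP=> _ /imsetP[z zS ->].
  have [->|zx] := eqVneq z x; last by apply: imset_f; rewrite !inE zx.
  by rewrite fxy; apply: imset_f; rewrite !inE yx.
have injx : {in S :\ x &, injective f}.
  apply/imset_injP; rewrite fx.
  by move: (cardsD1 x S); rewrite xS cS => -[->].
have fy : f @: (S :\ y) = f @: S.
  apply/eqP; rewrite eqEsubset imsetS ?subsetDl//=.
  apply/subsetP=> _ /imsetP[z zS ->].
  have [->|zy] := eqVneq z y; last by apply: imset_f; rewrite !inE zy.
  by rewrite -fxy; apply: imset_f; rewrite !inE xS eq_sym yx.
suff -> : [set z in S | f @: (S :\ z) == f @: S] = [set x; y].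
  by rewrite cards2 eq_sym yx.
apply/setP=> z; rewrite !inE; have [->|zx] /= := eqVneq z x.
  by rewrite xS fx eqxx.
have [->|zy] /= := eqVneq z y; first by rewrite yS fy eqxx.
apply/negP=> /andP[zS /eqP fz].
have /imsetP[w] : f z \in f @: (S :\ z) by rewrite fz imset_f.
rewrite !inE => /andP[wz wS] fzw.
have [wx|wx] := eqVneq w x.
  have := injx z y; rewrite !inE zx zS yx yS => /(_ isT isT).
  by rewrite fzw wx fxy => /(_ erefl) /eqP; rewrite (negPf zy).
have := injx z w; rewrite !inE zx zS wx wS => /(_ isT isT fzw) /eqP.
by rewrite eq_sym (negPf wz).
Qed.

Section scarf.
Variables (T I : finType) (r : I -> T -> nat).
Hypothesis r_inj : forall i, injective (r i).

(* Applied to [x] in [S]: every element of [S] is the minimum of [S] for some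
   order in [J]. *)
Definition dominant (S : {set T}) (J : {set I}) :=
  [forall x, exists i in J, forall s in S, r i x <= r i s].

Lemma dominantP (S : {set T}) (J : {set I}) :
  reflect (forall x, exists2 i, i \in J & forall s, s \in S -> r i x <= r i s)
    (dominant S J).
Proof.
apply: (iffP forallP) => H x.
  have /exists_inP[i iJ /forall_inP ?] := H x; by exists i.
have [i iJ ?] := H x; by apply/exists_inP; exists i => //; apply/forall_inP.
Qed.

Definition room (p : {set T} * {set I}) :=
  dominant p.1 p.2 && (#|p.1| == #|p.2|).

Definition adjacent (d p : {set T} * {set I}) :=
  (d.1 \subset p.1) && (p.2 \subset d.2).

(** The chain [#|d.1| <= #|p.1| = #|p.2| <= #|d.2| = #|d.1|.+1] makes exactly one of the two
    inclusions strict, by a single element. *)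
Lemma adjacentP (d p : {set T} * {set I}) :
  #|d.2| = #|d.1|.+1 -> #|p.1| = #|p.2| -> adjacent d p ->
  (p.1 = d.1 /\ exists2 i, i \in d.2 & p.2 = d.2 :\ i) \/
  (p.2 = d.2 /\ exists2 x, x \notin d.1 & p.1 = x |: d.1).
Proof.
case: d p => [U L] [S J] /= cL cS /andP[/= US JL].
have := subset_leq_card JL; rewrite leq_eqVlt => /orP[/eqP JLc|JLc].
  right; have {}JL : J = L by apply/eqP; rewrite eqEcard JL JLc /=.
  split=> //; have : U \proper S.
    by rewrite properEcard US cS JL cL ltnS /=.
  case/properP=> _ [x xS xU]; exists x => //; apply/esym/eqP.
  by rewrite eqEcard subUset sub1set xS US /= cardsU1 xU cS JL cL.
left; have SU : S = U.
  by apply/esym/eqP; rewrite eqEcard US cS -ltnS -cL.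
split=> //; have : J \proper L by rewrite properEcard JL.
case/properP=> _ [i iL iJ]; exists i => //; apply/eqP.
rewrite eqEcard subsetD1 JL iJ /= -cS SU -ltnS -cL.
by rewrite (cardsD1 i L) iL.
Qed.

(* Writing [m i] for the [r i]-minimum of [U], exactly two orders [i] in [L]
   have [m @: (L :\ i) = U].  Each of them gives one room: add to [U] the
   [r i]-largest point [x] with [r k (m k) < r k x] for all [k != i], or drop [i]
   from [L] if there is no such point. *)
Lemma room_card (U : {set T}) (L : {set I}) : U != set0 ->
  dominant U L -> #|L| = #|U|.+1 ->
  #|[set p | room p & adjacent (U, L) p]| = 2.
Proof.
case/set0Pn=> u0 u0U /dominantP domU cL.
pose m i : T := [arg min_(s < u0 in U) r i s].
have mU i : m i \in U by rewrite /m; case: arg_minnP.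
have mle i s : s \in U -> r i (m i) <= r i s.
  by rewrite /m; case: arg_minnP => // x _; apply.
have mE i s : s \in U -> r i s <= r i (m i) -> s = m i.
  by move=> sU ?; apply: (r_inj (i:=i)); apply/eqP; rewrite eqn_leq mle ?andbT.
have mL : m @: L = U.
  apply/eqP; rewrite eqEsubset; apply/andP; split.
    by apply/subsetP=> _ /imsetP[i _ ->].
  apply/subsetP=> s sU; have [i iL sm] := domU s.
  by rewrite (mE i s sU (sm _ (mU i))) imset_f.
have := card_redundant (f := m) (S := L); rewrite mL => /(_ cL).
set B := [set i in L | _]; move=> cB.
pose M i := [set x | [forall k in L :\ i, r k (m k) < r k x]].
have MP i x :
  reflect (forall k, k \in L -> k != i -> r k (m k) < r k x) (x \in M i).
  rewrite inE; apply: (iffP forall_inP) => H k; last first.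
    by rewrite !inE => /andP[ki kL]; exact: H.
  by move=> kL ki; apply: H; rewrite !inE ki.
have M_U i x : i \in B -> x \in M i -> x \notin U.
  rewrite [i \in B]inE => /andP[iL /eqP <-] /MP xM; apply/negP=> /imsetP[k].
  by rewrite !inE => /andP[ki kL] xk; have := xM k kL ki; rewrite xk ltnn.
have M_i i x : i \in L -> x \in M i -> forall s, s \in U -> r i x <= r i s.
  move=> iL /MP xM; have [k kL kx] := domU x.
  have [<-//|ki] := eqVneq k i.
  by have := xM k kL ki; rewrite ltnNge kx// mU.
pose g i := if [pick x in M i | [forall y in M i, r i y <= r i x]] is Some x
  then (x |: U, L) else (U, L :\ i).
have gP i : i \in L -> (M i = set0 /\ g i = (U, L :\ i)) \/
    (exists x, [/\ x \in M i, forall y, y \in M i -> r i y <= r i x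
       & g i = (x |: U, L)]).
  move=> iL; rewrite /g; case: pickP => [x /andP[xM /forall_inP xm]|H].
    by right; exists x.
  left; split=> //; apply/eqP; apply: contraT => /set0Pn[y yM].
  case: (@arg_maxnP _ y (mem (M i)) (r i) yM) => x xM xm.
  have := H x; rewrite [x \in _]xM /= => /negbT/forall_inPn[z zM].
  by have -> : r i z <= r i x by exact: xm.
have ginj : {in B &, injective g}.
  move=> i j iB jB; have := iB; have := jB.
  rewrite !inE => /andP[jL _] /andP[iL _].
  case: (gP i iL) => [[_ ->]|[x [xM _ ->]]];
    case: (gP j jL) => [[_ ->]|[y [yM _ ->]]].
  - move=> [] /setP/(_ i); rewrite !inE eqxx iL /= andbT.
    by move/esym/negbFE/eqP.
  - by move=> [] _ /setP/(_ i); rewrite !inE eqxx iL.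
  - by move=> [] _ /setP/(_ j); rewrite !inE eqxx jL.
  move=> [] /setP/(_ x); rewrite !inE eqxx (negPf (M_U _ _ iB xM)) /= orbF.
  move=> /esym/eqP xy; rewrite -{y}xy in yM.
  (* If [i != j], a point of both [M i] and [M j] exceeds [m k] for every [k] in [L], against
     dominance of [(U, L)]. *)
  apply/eqP; apply: contraT => ij; have [k kL kx] := domU x.
  have {}kx := kx _ (mU k).
  have [ki|ki] := eqVneq k i.
    have kj : k != j by rewrite ki.
    by have /MP/(_ k kL kj) := yM; rewrite ltnNge kx.
  by have /MP/(_ k kL ki) := xM; rewrite ltnNge kx.
rewrite -cB -(card_in_imset ginj).
congr #|pred_of_set _|; apply/setP=> p; rewrite inE.
apply/andP/imsetP; last first.
  case=> i iB ->; have:= iB; rewrite !inE => /andP[iL _].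
  have [[M0 ->]|[x [xM xm ->]]] := gP i iL.
    split; last by rewrite /adjacent /= subxx subsetDl.
    rewrite /room /= -eqSS -cL (cardsD1 i L) iL eqxx andbT.
    (* Emptiness of [M i] is precisely dominance of [(U, L :\ i)]. *)
    apply/dominantP=> x; have : x \notin M i by rewrite M0 inE.
    rewrite inE => /forall_inPn[k kL]; rewrite -leqNgt => kx; exists k => //.
    by move=> s sU; exact: leq_trans kx (mle _ _ sU).
  split; last by rewrite /adjacent /= subsetUr subxx.
  rewrite /room /= cardsU1 (M_U _ _ iB xM) cL eqxx andbT.
  apply/dominantP=> y; have [yM|] := boolP (y \in M i).
    exists i => // s; rewrite !inE => /orP[/eqP->|sU]; first exact: xm.
    exact: M_i yM s sU.
  rewrite inE => /forall_inPn[k kL]; rewrite -leqNgt => kx; exists k.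
    by move: kL; rewrite !inE => /andP[].
  move=> s; rewrite !inE => /orP[/eqP->|sU].
    move: kL; rewrite !inE => /andP[ki kL].
    by have /MP/(_ k kL ki) /ltnW := xM; exact: leq_trans.
  exact: leq_trans kx (mle _ _ sU).
case: p => S J [/andP[/= /dominantP domS /eqP cS] adj].
have /= := @adjacentP (U, L) (S, J) cL cS adj.
case=> [[SU [i iL JL]]|[JL [x xU SU]]]; subst S J.
  have iB : i \in B.
    rewrite !inE iL eqEsubset /=; apply/andP; split.
      by apply/subsetP=> _ /imsetP[k _ ->].
    apply/subsetP=> s sU; have [k kL sk] := domS s.
    by rewrite (mE k s sU (sk _ (mU k))) imset_f.
  exists i => //; have [[_ ->//]|[x [/MP xM _ _]]] := gP i iL.
  have [k] := domS x; rewrite !inE => /andP[ki kL] /(_ _ (mU k)).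
  by rewrite leqNgt xM.
(* The added point [x] is lowest in some order [i]. Each point of [U] is then the minimum for
   another order, so [m] is a bijection from [L :\ i] onto [U] and [i] lies in [B]. *)
have [i iL xi] := domS x.
have key s : s \in U -> exists k, [/\ k \in L, k != i, s = m k & r k s < r k x].
  move=> sU; have [k kL sk] := domS s; exists k.
  have sx : s != x by apply: contraNneq xU => <-.
  have skx : r k s <= r k x by apply: sk; rewrite !inE eqxx.
  split=> //; last by rewrite ltn_neqAle skx andbT (inj_eq (r_inj (i:=k))).
    apply: contra sx => /eqP ki.
    rewrite -(inj_eq (r_inj (i:=k))) eqn_leq skx /=.
    by rewrite ki xi// !inE sU orbT.
  by apply: mE => //; apply: sk; rewrite !inE mU orbT.
have mi : m @: (L :\ i) = U.
  apply/eqP; rewrite eqEsubset; apply/andP; split.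
    by apply/subsetP=> _ /imsetP[k _ ->].
  by apply/subsetP=> s /key[k [kL ki -> _]]; rewrite imset_f// !inE ki.
have minj : {in L :\ i &, injective m}.
  apply/imset_injP; rewrite mi; move: cL; rewrite (cardsD1 i L) iL add1n.
  by case=> ->.
have xM : x \in M i.
  apply/MP=> k kL ki; have [k' [k'L k'i mk lt]] := key _ (mU k).
  have /minj -> : m k = m k' by [].
  - by rewrite -mk.
  - by rewrite !inE ki.
  - by rewrite !inE k'i.
exists i; first by rewrite !inE iL mi eqxx.
have [[M0 _]|[y [yM ym ->]]] := gP i iL; first by move: xM; rewrite M0 inE.
congr (_ |: _, _); apply: (r_inj (i:=i)); apply/eqP.
(* Since [y] is in [M i], only the order [i] can witness dominance at [y], which puts [y] no higher
   than [x] in that order. *)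
rewrite eqn_leq ym//=; have [k kL yk] := domS y.
have [<-|ki] := eqVneq k i; first by apply: yk; rewrite !inE eqxx.
have := yk (m k); rewrite !inE mU orbT => /(_ isT).
by have /MP/(_ k kL ki) := yM; rewrite ltnNge => /negPf->.
Qed.

(** Dominance forbids an empty set of orders, so [i0] remains, and a single point is dominant for
    [i0] exactly when it is the maximum of [r i0]. *)
Lemma outer_room_card (x0 : T) (i0 : I) :
  #|[set p | room p & adjacent (set0, [set i0]) p]| = 1.
Proof.
case: (@arg_maxnP _ x0 predT (r i0) isT) => x _ xm.
apply/eqP/cards1P; exists ([set x], [set i0]); apply/setP=> -[S J].
rewrite !inE xpair_eqE; apply/andP/andP; last first.
  case=> /eqP-> /eqP->; rewrite /room /adjacent /= sub0set subxx !cards1 eqxx.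
  split=> //; rewrite andbT; apply/dominantP=> y.
  exists i0; first by rewrite inE.
  by move=> s; rewrite inE => /eqP->; exact: xm.
case=> /andP[/= /dominantP domS /eqP cS] /andP[/= _ Ji].
have [i iJ im] := domS x.
have ii : i = i0 by move/subsetP/(_ i iJ): Ji; rewrite inE => /eqP.
rewrite ii in iJ im.
have J1 : J = [set i0] by apply/eqP; rewrite eqEsubset Ji sub1set.
split; last by rewrite J1.
move/eqP: cS; rewrite J1 cards1 => /cards1P[s Ss].
rewrite Ss; apply/eqP; congr [set _]; apply: (r_inj (i:=i0)); apply/eqP.
by rewrite eqn_leq im ?Ss ?inE//= (xm s isT : r i0 s <= r i0 x).
Qed.

Variable c : T -> I.

(** By the cardinality condition, the points of a door have pairwise distinct colours. *)
Definition door (i0 : I) (d : {set T} * {set I}) :=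
  [&& dominant d.1 d.2, #|d.2| == #|d.1|.+1, i0 \in d.2
    & c @: d.1 == d.2 :\ i0].

(** The number is two or zero. With [i0] in [J], if the colours are [J :\ i0], one drops either of
    the two points that share a colour; if they are [(j |: J) :\ i0] with [j] outside [J], one adds
    the order [j] or drops the point coloured [j]. Otherwise there is no door. *)
Lemma door_card (i0 : I) (p : {set T} * {set I}) : room p ->
  c @: p.1 != p.2 -> 2 %| #|[set d | door i0 d & adjacent d p]|.
Proof.
case: p => S J /andP[/= /dominantP domS /eqP cS] cSJ.
have domS' (U : {set T}) : U \subset S -> dominant U J.
  move=> US; apply/dominantP=> x; have [i iJ im] := domS x; exists i => //.
  by move=> s /(subsetP US); exact: im.
have domJ' (L : {set I}) : J \subset L -> dominant S L.
  move=> JL; apply/dominantP=> x; have [i iJ im] := domS x; exists i => //.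
  exact: (subsetP JL).
have adjP d : door i0 d && adjacent d (S, J) ->
    (exists j, [/\ d = (S, j |: J), j \notin J, j != i0, i0 \in J
       & c @: S = (j |: J) :\ i0]) \/
    (exists x, [/\ d = (S :\ x, J), x \in S, i0 \in J
       & c @: (S :\ x) = J :\ i0]).
  case/andP; case: d => U L /and4P[/= _ /eqP cL iL /eqP cU] adj.
  case: (@adjacentP (U, L) (S, J) cL cS adj) => /= -[].
    move=> SU [j jL JL]; subst U; have LE : L = j |: J by rewrite JL setD1K.
    have ji : j != i0.
      by apply: contraNneq cSJ => ji; rewrite cU JL ji.
    left; exists j; rewrite -LE; split=> //; rewrite JL !inE ?eqxx//.
    by rewrite eq_sym ji.
  move=> JL [x xU SU]; subst L; right; exists x.
  have UE : U = S :\ x by rewrite SU setU1K.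
  by rewrite -UE; split=> //; rewrite SU !inE eqxx.
have [/andP[iJ /eqP cSi]|no1] := boolP ((i0 \in J) && (c @: S == J :\ i0)).
  have /card_redundant cR : #|S| = #|c @: S|.+1.
    by rewrite cSi cS (cardsD1 i0 J) iJ.
  rewrite (_ : [set d | _] =
    [set (S :\ x, J) | x in [set x in S | c @: (S :\ x) == c @: S]]).
    rewrite card_in_imset ?cR// => x y; rewrite !inE.
    move=> /andP[xS _] /andP[yS _] [] /setP/(_ x).
    by rewrite !inE eqxx xS !andbT /= => /esym/negbFE/eqP.
  apply/setP=> d; rewrite inE; apply/idP/imsetP.
    case/adjP=> [[j [_ jJ ji _]]|[x [-> xS _ cSx]]].
      by rewrite cSi => /setP/(_ j); rewrite !inE eqxx ji (negPf jJ).
    by exists x; rewrite // inE xS cSx cSi eqxx.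
  case=> x; rewrite inE => /andP[xS /eqP cSx] ->.
  rewrite /door /adjacent /= domS' ?subsetDl// iJ cSx cSi eqxx subxx.
  by rewrite -cS (cardsD1 x S) xS add1n eqxx.
have [/existsP[j /and3P[iJ jJ /eqP cSj]]|no2] :=
    boolP [exists j, [&& i0 \in J, j \notin J & c @: S == (j |: J) :\ i0]].
  have ji : j != i0 by apply: contraNneq jJ => ->.
  have jS : j \in c @: S by rewrite cSj !inE eqxx ji.
  have [x xS jE] := imsetP jS.
  have cinj : {in S &, injective c}.
    apply/imset_injP; rewrite cSj cS; have := cardsU1 j J.
    by rewrite jJ (cardsD1 i0 (j |: J)) !inE iJ orbT add1n => -[->].
  have cSx : c @: (S :\ x) = J :\ i0.
    apply/setP=> k; rewrite in_setD1; apply/imsetP/andP.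
      case=> y; rewrite in_setD1 => /andP[yx yS] ->.
      have := imset_f c yS; rewrite cSj !inE => /andP[-> /orP[/eqP cy|//]].
      by case/eqP: yx; apply: cinj; rewrite // cy.
    case=> ki kJ.
    have : k \in c @: S by rewrite cSj !inE ki kJ orbT.
    case/imsetP=> y yS ky; exists y => //; rewrite in_setD1 yS andbT.
    by apply: contraNneq jJ => yx; rewrite jE -yx -ky.
  rewrite (_ : [set d | _] = [set (S, j |: J); (S :\ x, J)]).
    rewrite cards2 xpair_eqE; have -> //: (S == S :\ x) = false.
    by apply/negP=> /eqP/setP/(_ x); rewrite !inE eqxx xS.
  apply/setP=> d; rewrite !inE; apply/idP/orP.
    case/adjP=> [[k [-> kJ ki _]]|[y [-> yS _ cSy]]].
      rewrite cSj => /setP/(_ k); rewrite !inE eqxx ki (negPf kJ) orbF /=.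
      by move=> /eqP ->; left.
    right; rewrite xpair_eqE eqxx andbT; apply/eqP; congr (_ :\ _).
    apply/eqP; apply: contraT => yx.
    have : j \in c @: (S :\ y) by rewrite jE imset_f// !inE eq_sym yx.
    by rewrite cSy !inE (negPf jJ) andbF.
  case=> /eqP->; rewrite /door /adjacent /=.
    rewrite (domJ' _ (subsetU1 j J)) cSj eqxx subxx subsetU1 !inE iJ orbT.
    by rewrite cardsU1 jJ cS add1n eqxx.
  rewrite domS' ?subsetDl// iJ cSx eqxx subxx.
  by rewrite -cS (cardsD1 x S) xS add1n eqxx.
rewrite (_ : [set d | _] = set0) ?cards0//; apply/setP=> d; rewrite !inE.
apply/negP=> /adjP[[j [_ jJ ji iJ cSj]]|[x [_ xS iJ cSx]]].
  by case/existsP: no2; exists j; rewrite iJ jJ cSj eqxx.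
(* The colour of the dropped [x] decides: [i0] makes the room fully coloured, another element of [J]
   gives the first case, and a colour outside [J] the second. *)
have cSE : c @: S = c x |: (J :\ i0) by rewrite -cSx -imsetU1 setD1K.
have [cxi|cxi] := eqVneq (c x) i0.
  by case/eqP: cSJ; rewrite cSE cxi setD1K.
have [cxJ|cxJ] := boolP (c x \in J).
  case/andP: no1; split=> //; rewrite cSE; apply/eqP/setUidPr.
  by rewrite sub1set !inE cxi.
case/existsP: no2; exists (c x); rewrite iJ cxJ cSE; apply/eqP/setP=> k.
by rewrite !inE; case: eqVneq => [->|]//; rewrite cxi.
Qed.

(* Double counting of the incident pairs of a door and a room: every door lies
   in two rooms except [(set0, [set i0])], which lies in one, so some room lies
   on an odd number of doors. *)
Lemma scarf (x0 : T) (i0 : I) : exists S, dominant S (c @: S).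
Proof.
apply: contrapT => noS.
have dbl : \sum_(d | door i0 d) #|[set p | room p & adjacent d p]| =
    \sum_(p | room p) #|[set d | door i0 d & adjacent d p]|.
  under eq_bigr do rewrite -sum1dep_card big_mkcondr.
  rewrite exchange_big /=; apply: eq_bigr => p _.
  by rewrite -sum1dep_card [RHS]big_mkcondr.
have even_rooms : 2 %| \sum_(p | room p) #|[set d | door i0 d & adjacent d p]|.
  apply: dvdn_sum => -[S J] roomp; apply: door_card => //=.
  apply: contra_notN noS => /eqP cSJ; exists S; rewrite cSJ.
  by case/andP: roomp.
move: even_rooms; rewrite -dbl (bigD1 (set0, [set i0])) /=; last first.
  rewrite /door /= imset0 cards0 cards1 setDv inE !eqxx !andbT.
  by apply/dominantP=> x; exists i0 => [|s]; rewrite !inE.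
rewrite (outer_room_card x0) dvdn_addl //.
apply: dvdn_sum => -[U L] /andP[/and4P[/= domU /eqP cL iL /eqP cU] UL].
(* A door without points is the outer one: its colour condition reduces [L] to [i0]. *)
rewrite room_card//; apply: contra UL => /eqP U0.
rewrite U0 xpair_eqE eqxx /=; move: cU; rewrite U0 imset0 => /esym/eqP.
by rewrite setD_eq0 => L1; rewrite eqEsubset L1 sub1set.
Qed.

End scarf.

Lemma sum_eq_below (I : finType) (b : I -> nat) (N : nat) :
  N <= \sum_i b i ->
  exists2 a : I -> nat, forall i, a i <= b i & \sum_i a i = N.
Proof.
move=> /subnKC; move: (_ - _) => k; elim: k b => [|k IH] b bE.
  by exists b; rewrite // -bE addn0.
have [i bi] : exists i, 0 < b i.
  apply/existsP; apply: contraT; rewrite negb_exists => /forallP b0.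
  move: bE; rewrite big1 ?addnS// => i _; move: (b0 i).
  by rewrite -leqNgt leqn0 => /eqP.
have [|a ab aE] := IH (fun j => b j - (j == i)).
  apply: succn_inj; rewrite -addnS bE (bigD1 i)//= [in RHS](bigD1 i)//= eqxx.
  rewrite -addSn subn1 prednK//; congr (_ + _); apply: eq_bigr => j /negPf->.
  by rewrite subn0.
by exists a => // j; exact: leq_trans (ab j) (leq_subr _ _).
Qed.

(** Each grid point is coloured by an index that the hypothesis supplies. The corners of the grid
    force the dominant set [S] to show every colour, and the coordinatewise maxima of [S] sum to
    less than [N + #|I|], which bounds its spread. *)
Lemma grid_kkm (I : finType) (i0 : I) (N : nat) (P : I -> (I -> nat) -> Prop) :
  (forall a, \sum_i a i = N -> exists2 i, 0 < a i & P i a) ->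
  exists s : I -> I -> nat, [/\ forall i, \sum_j s i j = N,
    forall i, P i (s i) & forall i i' j, s i j <= s i' j + #|I|].
Proof.
move=> hP; pose T : finType := {a : {ffun I -> 'I_N.+1} | \sum_i a i == N}.
pose pt (a : T) i : nat := val a i.
have pt_sum a : \sum_i pt a i = N by apply/eqP; exact: (valP a).
have ptP (a : I -> nat) : \sum_i a i = N -> exists x : T, pt x =1 a.
  move=> aN; have aS i : a i < N.+1 by rewrite ltnS -aN (bigD1 i)//= leq_addr.
  have aT : \sum_i [ffun i => Ordinal (aS i)] i == N.
    by rewrite -[X in _ == X]aN; apply/eqP/eq_bigr => i _; rewrite ffunE.
  by exists (Sub [ffun i => Ordinal (aS i)] aT) => i; rewrite /pt SubK ffunE.
have [|c hc] := @choice T I (fun x i => 0 < pt x i /\ P i (pt x)).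
  by move=> x; have [i] := hP _ (pt_sum x); exists i.
have [x0 _] : exists x : T, pt x =1 fun i => if i == i0 then N else 0.
  by apply: ptP; rewrite -big_mkcond big_pred1_eq.
(* Ranks decrease with the coordinate, so that dominance at a grid point bounds some coordinate of
   all of [S] by that of the point; [enum_rank], smaller than [#|T|], only breaks ties. *)
pose r i (x : T) := (N - pt x i) * #|T| + enum_rank x.
have r_inj i : injective (r i).
  move=> x y /(congr1 (modn^~ #|T|)); rewrite !modnMDl !modn_small//.
  by move/val_inj/enum_rank_inj.
have r_le i x y : r i x <= r i y -> pt y i <= pt x i.
  apply: contraTT; rewrite -!ltnNge => xy.
  have yN : pt y i <= N by rewrite -ltnS; exact: ltn_ord.
  apply: (@leq_trans ((N - pt y i).+1 * #|T|)).
    by rewrite /r mulSn [X in _ < X]addnC ltn_add2l.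
  apply: leq_trans (leq_addr _ _).
  by rewrite leq_mul2r ltn_sub2l ?orbT// (leq_trans xy).
have [S /dominantP domS] := scarf r_inj c x0 i0.
have {domS} domS a : \sum_i a i = N ->
    exists2 i, i \in c @: S & forall x, x \in S -> pt x i <= a i.
  move=> /ptP[y ya]; have [i iJ im] := domS y; exists i => // x /im.
  by rewrite -ya; exact: r_le.
have cT i : i \in c @: S.
  apply: contraT => iS.
  (* At the corner with all its mass at [i], dominance gives a colour [j] at which the corner bounds
     all of [S]. A point of colour [j] is positive there, so [j = i]. *)
  have [|j] := domS (fun j => if j == i then N else 0).
    by rewrite -big_mkcond big_pred1_eq.
  case/imsetP=> x xS -> /(_ x xS); have := (hc x).1.
  case: eqVneq => [ci|_]; last by case: (pt x _).
  by move: iS; rewrite -ci imset_f.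
have /choice[x xP] : forall i, exists x, x \in S /\ c x = i.
  by move=> i; have /imsetP[x xS ->] := cT i; exists x.
exists (fun i => pt (x i)); split=> // [i|i i' j].
  by have [_ ci] := xP i; rewrite -{1}ci; apply: (hc _).2.
pose M j := \max_(y in S) pt y j.
have ptM y k : y \in S -> pt y k <= M k.
  by move=> yS; rewrite /M (bigD1 y)//= leq_maxl.
have M0 k : 0 < M k.
  by have [yS <-] := xP k; apply: leq_trans (ptM _ _ yS); exact: (hc _).1.
have sumM : \sum_k M k < N + #|I|.
  (* Otherwise some grid point lies below every [(M k).-1], and dominance at that point bounds some
     [M k] by its own predecessor. *)
  have Mpred : \sum_k (M k).-1 < N.
    rewrite ltnNge; apply/negP=> /sum_eq_below[a aM aN].
    have [k _ kS] := domS a aN.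
    have : M k <= (M k).-1.
      by apply/bigmax_leqP => y yS; exact: leq_trans (kS y yS) (aM k).
    by rewrite leqNgt prednK ?leqnn.
  rewrite (_ : \sum_k M k = \sum_k (M k).-1 + #|I|) ?ltn_add2r//.
  rewrite -sum1_card -big_split /=; apply: eq_bigr => k _.
  by rewrite addn1 prednK.
have [[xS _] [x'S _]] := (xP i, xP i').
apply: (leq_trans (ptM _ j xS)).
(* Since [x i'] sums to [N] and stays below [M], it is exceeded by [M] at [j] by at most [#|I|]. *)
move: sumM; rewrite -(pt_sum (x i')) (bigD1 j)//= [X in _ < X + _](bigD1 j)//=.
rewrite addnAC => /ltnW H; rewrite -(leq_add2r (\sum_(k | k != j) M k)).
apply: leq_trans H _; rewrite leq_add2l.
by apply: leq_sum => k _; exact: ptM.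
Qed.

From HB Require Import structures.
From mathcomp Require Import all_boot all_order all_algebra.
From mathcomp Require Import all_classical all_reals all_analysis.
From mathcomp Require Import ring lra.

Import Order.TTheory GRing.Theory Num.Theory.
Import numFieldNormedType.Exports.

Local Open Scope classical_set_scope.
Local Open Scope ring_scope.

(** * Hahn-Banach and weak compactness *)

Section weak_topology.
Context {R : realType} (X : normedModType R).

Lemma weak_cvgP (F : set_system X) (x : X) : Filter F ->
  F --> (x : weak X) <->
  forall phi : dual X, phi z @[z --> F] --> (phi x : R^o).
Proof.
move=> FF; split=> [Fx phi|Fx].
  have /cvg_sup/(_ phi) Fphi := Fx.
  apply: cvg_trans (@initial_continuous X R^o phi x).
  exact: cvg_app Fphi.
apply/cvg_sup => phi A /= [_ [[B Bop <-] Bx BA]].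
have FB : F (phi @^-1` B) by apply: (Fx phi); rewrite nbhsE; exists B.
exact: filterS BA FB.
Qed.

Lemma weak_cvg_funP (T : Type) (F : set_system T) (g : T -> X) (x : X) :
  Filter F -> g t @[t --> F] --> (x : weak X) <->
  forall phi : dual X, phi (g t) @[t --> F] --> (phi x : R^o).
Proof. by move=> FF; exact: (@weak_cvgP (g @ F) x (fmap_filter g FF)). Qed.

Lemma weak_continuous_dual (phi : dual X) : continuous (phi : weak X -> R^o).
Proof.
move=> x; have [+ _] := @weak_cvgP (nbhs (x : weak X)) x _; apply.
exact: cvg_id.
Qed.

End weak_topology.

Section convex_sets.
Context {R : realType} (E : lmodType R).

Lemma convex_setP (K : set E) : convex_set K <->
  forall x y t, K x -> K y -> 0 <= t -> t <= 1 -> K (t *: x + (1 - t) *: y).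
Proof.
split=> [cK x y t Kx Ky t0 t1|cK x y t].
  exact/set_mem/(cK x y (Itv01 t0 t1) (mem_set Kx) (mem_set Ky)).
by rewrite !inE => Kx Ky; apply: (cK x y (t%:num)).
Qed.

Lemma convex_set1 (x : E) : convex_set [set x].
Proof.
apply/convex_setP => _ _ t /= -> -> _ _.
by rewrite -scalerDl addrC subrK scale1r.
Qed.

End convex_sets.

Section sublinear.
Context {R : realType} (E : lmodType R).
Implicit Types q : E -> R.

Definition sublinear q := (forall x y, q (x + y) <= q x + q y) /\
  (forall t x, 0 < t -> q (t *: x) <= t * q x).

Lemma sublinear0 q : sublinear q -> q 0 = 0.
Proof.
move=> [qD qZ]; have := qD 0 0; have := qZ (1 / 2) 0; rewrite scaler0 addr0.
by move=> /(_ ltac:(lra)); lra.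
Qed.

Lemma sublinearZ q t x : sublinear q -> 0 <= t -> q (t *: x) = t * q x.
Proof.
move=> sq; rewrite le_eqVlt => /orP[/eqP<-|t0].
  by rewrite scale0r mul0r sublinear0.
apply/eqP; rewrite eq_le; apply/andP; split; first exact: sq.2.
rewrite -ler_pdivlMl// -[in leLHS](scalerK (lt0r_neq0 t0) x).
by apply: sq.2; rewrite invr_gt0.
Qed.

Lemma sublinearN q x : sublinear q -> - q (- x) <= q x.
Proof.
by move=> sq; have := sq.1 x (- x); rewrite subrr sublinear0//; lra.
Qed.

(* The infimum is finite because [q (t *: k) <= q (v + t *: k) + q (- v)]. *)
Lemma sublinear_lower q (K : set E) (d : R) : sublinear q ->
    convex_set K -> K !=set0 -> (forall k, K k -> d <= q k) ->
  exists q', [/\ sublinear q', forall v, q' v <= q v &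
    forall k, K k -> q' (- k) <= - d].
Proof.
move=> sq Kconv [k0 Kk0] dK.
(* The infimum of [V v] is the largest possible value: a sublinear minorant [q'] of [q] with
   [q' (- k) <= - d] satisfies [q' v <= q' (v + t *: k) + t * q' (- k)], which is at most
   [q (v + t *: k) - t * d]. *)
pose V v := [set q (v + p.1 *: p.2) - p.1 * d |
  p in [set p : R * E | 0 <= p.1 /\ K p.2]].
have Vlb v : lbound (V v) (- q (- v)).
  move=> _ [[t k] /= [t0 Kk] <-].
  have := sq.1 (v + t *: k) (- v); rewrite addrAC subrr add0r sublinearZ//.
  have := ler_wpM2l t0 (dK k Kk); lra.
have Vhas v : has_inf (V v).
  split; last by exists (- q (- v)).
  by exists (q (v + 0 *: k0) - 0 * d), (0, k0).
have Vinf v (t : R) k : 0 <= t -> K k -> inf (V v) <= q (v + t *: k) - t * d.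
  by move=> t0 Kk; apply: ge_inf; [exact: (Vhas v).2|exists (t, k)].
have Vge v (y : R) :
    (forall (t : R) k, 0 <= t -> K k -> y <= q (v + t *: k) - t * d) ->
    y <= inf (V v).
  move=> H; apply: lb_le_inf; first exact: (Vhas v).1.
  by move=> _ [[t k] /= [t0 Kk] <-]; exact: H.
exists (fun v => inf (V v)); split.
- split=> [x y|t x t0].
  + rewrite -lerBlDr; apply: (Vge) => t k t0 Kk.
    rewrite lerBlDr -lerBlDl; apply: (Vge) => s l s0 Kl.
    have [ts0|ts0] := eqVneq (t + s) 0.
      have [-> ->] : t = 0 /\ s = 0 by split; lra.
      have := Vinf (x + y) 0 k0 (lexx _) Kk0.
      rewrite !scale0r !addr0; have := sq.1 x y; lra.
    have tsgt0 : 0 < t + s by rewrite lt_neqAle eq_sym ts0 addr_ge0.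
    pose m := (t / (t + s)) *: k + (s / (t + s)) *: l.
    have Km : K m.
      have ts : s / (t + s) = 1 - t / (t + s) by field.
      rewrite /m ts; apply/(convex_setP _).1 => //.
        by apply: divr_ge0 => //; exact: ltW.
      by rewrite ler_pdivrMr// mul1r lerDl.
    have := Vinf (x + y) (t + s) m (ltW tsgt0) Km.
    have -> : x + y + (t + s) *: m = (x + t *: k) + (y + s *: l).
      by rewrite /m scalerDr !scalerA !(mulrC (t + s)) !divfK// addrACA.
    by move: (sq.1 (x + t *: k) (y + s *: l)); clear; lra.
  rewrite -ler_pdivrMl//; apply: (Vge) => s k s0 Kk.
  rewrite ler_pdivrMl//; apply: le_trans (Vinf _ (t * s) k _ Kk) _.
    by rewrite mulr_ge0// ltW.
  by rewrite -scalerA -scalerDr (sublinearZ _ sq (ltW t0)) mulrBr mulrA.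
- move=> v; apply: le_trans (Vinf v 0 k0 (lexx _) Kk0) _.
  by rewrite scale0r mul0r addr0 subr0.
- move=> k Kk; apply: le_trans (Vinf _ 1 k ler01 Kk) _.
  by rewrite scale1r addNr sublinear0// mul1r sub0r.
Qed.

(** Zorn's lemma for the reversed pointwise order on the sublinear minorants of [p]: the pointwise
    infimum of a chain is sublinear, and finite because [- p (- v)] is a lower bound. *)
Lemma sublinear_minimal p : sublinear p ->
  exists q, [/\ sublinear q, forall v, q v <= p v &
    forall q', sublinear q' -> (forall v, q' v <= q v) ->
      forall v, q v <= q' v].
Proof.
move=> sp; pose T := {q : E -> R | sublinear q /\ forall v, q v <= p v}.
pose ge_fun (a b : T) := `[< forall v, projT1 b v <= projT1 a v >].
have [//|a b c /asboolP ab /asboolP bc|A Atot|[q [sq qp]] qmin] :=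
    @ZL_preorder T (exist _ p (conj sp (fun=> lexx _))) ge_fun.
- by move=> a; apply/asboolP.
- by apply/asboolP => v; exact: le_trans (bc v) (ab v).
- have [->|/set0P[a0 Aa0]] := eqVneq A set0.
    by exists (exist _ p (conj sp (fun=> lexx _))).
  pose V v := [set projT1 a v | a in A].
  have Vhas v : has_inf (V v).
    split; first by exists (projT1 a0 v), a0.
    exists (- p (- v)) => _ [[a [/= sa ap]] _ <-].
    by apply: le_trans (sublinearN v sa); rewrite lerN2.
  have Vinf v a : A a -> inf (V v) <= projT1 a v.
    by move=> Aa; apply: ge_inf; [exact: (Vhas v).2|exists a].
  have Vge v (y : R) : (forall a, A a -> y <= projT1 a v) -> y <= inf (V v).
    move=> H; apply: lb_le_inf; first exact: (Vhas v).1.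
    by move=> _ [a Aa <-]; exact: H.
  have sV : sublinear (fun v => inf (V v)) /\ forall v, inf (V v) <= p v.
    split; last by move=> v; apply: le_trans (Vinf v _ Aa0) ((projT2 a0).2 v).
    split=> [x y|t x t0].
      rewrite -lerBlDr; apply: (Vge) => a Aa.
      rewrite lerBlDr -lerBlDl; apply: (Vge) => b Ab; rewrite lerBlDl.
      (* Subadditivity of the infimum needs one member below both [a] and [b], which a chain
         provides. *)
      have [c [Ac ca cb]] : exists c, [/\ A c,
          forall v, projT1 c v <= projT1 a v &
          forall v, projT1 c v <= projT1 b v].
        have [/asboolP ba|/asboolP ab] := Atot b a Ab Aa; first by exists a.
        by exists b.
      apply: le_trans (Vinf _ _ Ac) _; apply: le_trans ((projT2 c).1.1 x y) _.
      exact: lerD.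
    rewrite -ler_pdivrMl//; apply: (Vge) => a Aa; rewrite ler_pdivrMl//.
    exact: le_trans (Vinf _ _ Aa) ((projT2 a).1.2 t x t0).
  exists (exist _ (fun v => inf (V v)) sV) => a Aa.
  by apply/asboolP => v /=; exact: Vinf.
exists q; split=> // q' sq' q'q.
have q'p v : q' v <= p v by exact: le_trans (qp v).
have := qmin (exist _ q' (conj sq' q'p)).
by rewrite /ge_fun /= asboolT// => /(_ isT) /asboolP.
Qed.

(** Minimality makes [q] odd, and for an odd sublinear function subadditivity at the opposite
    vectors gives the reverse inequality. *)
Lemma sublinear_minimal_linear q : sublinear q ->
    (forall q', sublinear q' -> (forall v, q' v <= q v) ->
      forall v, q v <= q' v) ->
  linear (q : E -> R^o).
Proof.
move=> sq qmin; have qN a : q (- a) = - q a.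
  (* [q'] lowers [q] at [- a], which minimality forbids. *)
  have [q' [sq' q'q q'a]] : exists q', [/\ sublinear q', forall v, q' v <= q v &
      forall k, k = a -> q' (- k) <= - q a].
    apply: (@sublinear_lower q [set a]) => //.
    - exact: convex_set1.
    - by exists a.
    - by move=> k ->.
  apply/eqP; rewrite eq_le (le_trans (qmin q' sq' q'q _) (q'a _ erefl))/=.
  by have := sublinearN (- a) sq; rewrite opprK.
have qZ t x : q (t *: x) = t * q x.
  have [t0|/ltW t0] := leP 0 t; first exact: sublinearZ.
  rewrite -[in LHS](opprK t) scaleNr qN sublinearZ ?oppr_ge0//.
  by rewrite mulNr opprK.
move=> t x y; rewrite -[LHS]/(q (t *: x + y)) -[RHS]/(t * q x + q y) -qZ.
apply/eqP; rewrite eq_le; apply/andP; split; first exact: sq.1.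
by have := sq.1 (- (t *: x)) (- y); rewrite -opprD !qN; lra.
Qed.

(** A minimal sublinear function below the one from [sublinear_lower] is linear, and its upper bound
    at [- k] becomes a lower bound at [k]. *)
Lemma hahn_banach_sandwich q (K : set E) (d : R) : sublinear q ->
    convex_set K -> K !=set0 -> (forall k, K k -> d <= q k) ->
  exists phi : E -> R^o, [/\ linear phi, forall v, phi v <= q v &
    forall k, K k -> d <= phi k].
Proof.
move=> sq cK K0 dK; have [q' [sq' q'q q'K]] := sublinear_lower sq cK K0 dK.
have [phi [sphi phiq' phimin]] := sublinear_minimal sq'.
exists phi; split.
- exact: sublinear_minimal_linear.
- by move=> v; exact: le_trans (q'q v).
- move=> k Kk; rewrite -[k]opprK; apply: le_trans (sublinearN _ sphi).
  rewrite opprK.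
  by have := le_trans (phiq' (- k)) (q'K _ Kk); rewrite lerNr.
Qed.

End sublinear.

Section weak_compactness.
Context {R : realType}.

Lemma bounded_functional (X : normedModType R) (phi : X -> R^o) (M : R) :
  linear phi -> (forall v, `|phi v| <= M * `|v|) ->
  phi \in @continuous_functional R X.
Proof.
move=> lphi phiM.
pose mphi := GRing.isLinear.Build R X R^o _ phi lphi.
pose L : {linear X -> R^o} := HB.pack phi mphi.
apply/asboolP; split=> //; apply: (@bounded_linear_continuous _ _ _ L).
apply/bounded_funP => s; exists (`|M| * s) => v vs.
apply: le_trans (phiM v) _.
apply: le_trans (ler_wpM2r (normr_ge0 v) (ler_norm M)) _.
exact: ler_wpM2l.
Qed.

Variable X : normedModType R.

(** A ball of radius [e] about [x] misses [K], so the norm is at least [e] on [K - x]; the sandwich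
    between [e] and the norm gives a functional of norm at most one. *)
Lemma closed_convex_separation (K : set X) (x : X) :
  closed K -> convex_set K -> ~ K x ->
  exists (phi : dual X) (e : R), 0 < e /\ forall k, K k -> phi x + e <= phi k.
Proof.
move=> clK cK Kx.
have [K0|/set0P[k0 Kk0]] := eqVneq K set0.
  by exists 0, 1; split=> // k; rewrite K0.
have /nbhs_ballP[e /= e0 eK] : nbhs x (~` K).
  by apply: open_nbhs_nbhs; split=> //; exact: closed_openC.
have snorm : sublinear (fun v : X => `|v|).
  split=> [u v|t v t0]; first exact: ler_normD.
  by rewrite normrZ gtr0_norm.
have [||k|phi [lphi phi_le phiK]] := @hahn_banach_sandwich _ _ _
    [set k - x | k in K] e snorm.
- apply/convex_setP => _ _ t [k Kk <-] [l Kl <-] t0 t1.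
  exists (t *: k + (1 - t) *: l); first exact: (convex_setP K).1.
  rewrite !scalerBr addrACA -opprD -(scalerDl x).
  by rewrite (addrC t) subrK scale1r.
- by exists (k0 - x), k0.
- case=> l Kl <-; rewrite leNgt; apply/negP => lx; apply: (eK l) => //.
  by rewrite -ball_normE /ball_/= distrC.
have phi_bnd v : `|phi v| <= 1 * `|v|.
  rewrite mul1r ler_norml phi_le andbT lerNl -normrN.
  have phi0 : phi 0 = 0.
    by have := lphi (-1) 0 0; rewrite !scaleN1r oppr0 addr0 addNr.
  by have := lphi (-1) v 0; rewrite !scaleN1r phi0 !addr0 => <-; exact: phi_le.
exists (Dual (bounded_functional lphi phi_bnd)), e; split=> // k Kk /=.
have /phiK : [set k - x | k in K] (k - x) by exists k.
have := lphi (-1) x k; rewrite !scaleN1r (addrC (- x)) => ->.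
rewrite -[_ + _]/(- phi x + phi k); lra.
Qed.

(** Mazur's theorem: a separating functional gives a weakly open half-space around [x] that misses
    [K]. *)
Lemma weakly_closed_convex (K : set X) : closed K -> convex_set K ->
  closed (K : set (weak X)).
Proof.
move=> clK cK x Kx; apply: contrapT => nKx.
have [phi [e [e0 phiK]]] := closed_convex_separation clK cK nKx.
have /Kx[y [Ky /=]] : nbhs (x : weak X) (phi @^-1` [set t | t < phi x + e]).
  apply: (@weak_continuous_dual _ _ phi x).
  by apply: lt_nbhsl; rewrite ltrDl.
by rewrite ltNge phiK.
Qed.

Lemma ultra_compact_cvg (T : Type) (V : topologicalType) (F : set_system T)
    (f : T -> V) (K : set V) :
  UltraFilter F -> compact K -> F (f @^-1` K) ->
  exists2 l, K l & f x @[x --> F] --> l.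
Proof.
move=> FU cK FK; have [l [Kl lF]] := cK (f @ F) _ FK.
exists l => // A lA; have [//|FA] := in_ultra_setVsetC (f @^-1` A) FU.
by have [y []] := lF (~` A) A FA lA.
Qed.

(** Along an ultrafilter on [K] every functional converges, its values lying in a compact segment.
    The limits form a bounded linear functional on the dual, which reflexivity represents by a point
    [z]. This is the weak limit, and it lies in [K] because [K] is weakly closed. *)
Lemma weakly_compact_bounded_convex (K : set X) (r : R) : reflexive_space X ->
  closed K -> convex_set K -> (forall x, K x -> `|x| <= r) ->
  compact (K : set (weak X)).
Proof.
move=> Xrefl clK cK Kr; rewrite compact_ultra => F FU FK.
have r0 : 0 <= r.
  by have [x /Kr] := filter_ex FK; exact: le_trans.
have /choice[L LP] : forall phi : dual X, exists l : R^o,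
    `|l| <= r * `|phi| /\ phi x @[x --> F] --> (l : R^o).
  move=> phi; set M := r * `|phi|.
  have [|l] := ultra_compact_cvg (f := phi) FU (@segment_compact R (- M) M).
    apply: (filterS _ FK) => x /Kr xr; rewrite /preimage/= in_itv/= -ler_norml.
    apply: le_trans (dual_norm_bound phi x) _.
    by rewrite mulrC; exact: (ler_wpM2r (dual_norm_ge0 phi) xr).
  by rewrite /= in_itv/= -ler_norml => lM lF; exists l.
have lL : linear L.
  move=> t phi psi.
  have /cvg_unique := (LP (t *: phi + psi)).2; apply=> //.
  exact: (cvgD (cvgZr (LP phi).2) (LP psi).2).
have [z _ zL] : range (@bidual_embedding R X)
    (Dual (bounded_functional lL (fun phi => (LP phi).1))).
  by rewrite Xrefl.
have Fz : F --> (z : weak X).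
  apply/(weak_cvgP z _) => phi; have [_] := LP phi.
  by have /(congr1 (fun g : dual (dual X) => g phi)) /= <- := zL.
exists z; split=> //; apply: (weakly_closed_convex clK cK) => A /Fz FA.
exact: (filter_ex (filterI FK FA)).
Qed.

End weak_compactness.

(** * Cones and convex combinations *)

Section cone_interior.
Context {R : realType} {Z : tvsType R} (C : set Z).
Hypotheses (Ccone : cone C) (Cconvex : cone_convex C).

Local Notation negint := (-%R @` C^°).

Lemma coneD (x y : Z) : C x -> C y -> C (x + y).
Proof. by move=> Cx Cy; rewrite -Cconvex; exists x => //; exists y. Qed.

Lemma negintE (z : Z) : negint z = C^° (- z).
Proof.
apply/propext; split=> [[c Cc <-]|Cz]; first by rewrite opprK.
by exists (- z); rewrite ?opprK.
Qed.

Lemma interior_coneD (x y : Z) : C^° x -> C y -> C^° (x + y).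
Proof.
move=> Cx Cy; have sub_cont : {for x + y, continuous (fun z : Z => z - y)}.
  apply: (@continuous_comp _ _ _ (fun z : Z => (z, - y))
    (fun p : Z * Z => p.1 + p.2)).
    by apply: cvg_pair => /=; [exact: cvg_id|exact: cvg_cst].
  exact: add_continuous.
have : nbhs (x + y) (fun z : Z => C (z - y)) by apply: sub_cont; rewrite addrK.
by apply: filterS => z Cz; rewrite -(subrK y z); exact: coneD.
Qed.

Lemma interior_coneZ (t : R) (x : Z) : 0 < t -> C^° x -> C^° (t *: x).
Proof.
move=> t0 Cx.
have scale_cont : {for t *: x, continuous (fun z : Z => t^-1 *: z)}.
  apply: (@continuous_comp _ _ _ (fun z : Z => (t^-1 : R^o, z))
    (fun p : R^o * Z => p.1 *: p.2)).
    apply: (@cvg_pair _ _ _ _ (nbhs (t^-1 : R^o))); first exact: cvg_cst.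
    exact: cvg_id.
  exact: scale_continuous.
have : nbhs (t *: x) (fun z : Z => C (t^-1 *: z)).
  by apply: scale_cont; rewrite scalerK// lt0r_neq0.
apply: filterS => z /Ccone/(_ (ltW t0)).
by rewrite scalerA divff ?scale1r// lt0r_neq0.
Qed.

Lemma negint_nbhs (z : Z) : negint z -> nbhs z negint.
Proof.
rewrite negintE => Cz; have : nbhs z (-%R @^-1` C^°).
  apply: opp_continuous; apply: open_nbhs_nbhs; split=> //.
  exact: open_interior.
by apply: filterS => w; rewrite negintE.
Qed.

Lemma negint_le (z1 z2 : Z) : cone_le C z1 z2 -> negint z2 -> negint z1.
Proof.
rewrite !negintE => C12 Cz2.
by have := interior_coneD Cz2 C12; rewrite addrA addNr add0r.
Qed.

Lemma negintZ (t : R) (z : Z) : 0 < t -> negint z -> negint (t *: z).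
Proof. by rewrite !negintE -scalerN; exact: interior_coneZ. Qed.

(** Some weight is positive and puts its term in [- int C]; the other terms lie in [- C], and adding
    them does not leave [- int C]. *)
Lemma negint_sum (n : nat) (l : 'I_n -> R) (z : 'I_n -> Z) :
  (forall i, 0 <= l i) -> \sum_i l i = 1 ->
  (forall i, 0 < l i -> negint (z i)) -> negint (\sum_i l i *: z i).
Proof.
move=> l0 l1 lz; have [i li] : exists i, 0 < l i.
  apply: contrapT => nl; have : \sum_i l i = 0.
    apply: big1 => i _; apply/eqP; rewrite eq_le l0 andbT leNgt.
    by apply/negP => li; apply: nl; exists i.
  by rewrite l1 => /eqP; rewrite oner_eq0.
have Ci := negintZ li (lz i li); have C0 : C 0.
  move: Ci; rewrite negintE => /interior_subset/Ccone/(_ (lexx 0)).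
  by rewrite scale0r.
rewrite (bigD1 i)// negintE opprD; move: Ci; rewrite negintE => Ci.
apply: interior_coneD Ci _.
apply: (big_ind (fun s => C (- s))) => [|x y Cx Cy|j _].
- by rewrite oppr0.
- by rewrite opprD; exact: coneD.
have := l0 j; rewrite le_eqVlt => /orP[/eqP<-|lj].
  by rewrite scale0r oppr0.
by apply: interior_subset; rewrite -negintE; apply: negintZ => //; exact: lz.
Qed.

(** Semicontinuity is applied to the neighbourhood [- int C] of [g x], which is stable under
    subtracting [C]. *)
Lemma cone_usc_negint (T : topologicalType) (K : set T) (g : T -> Z) (x : T) :
  cone_usc_at T C K g x -> negint (g x) ->
  \forall u \near x, K u -> negint (g u).
Proof.
move=> usc /negint_nbhs/usc[U xU UK]; apply: filterS xU => u Uu Ku.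
have [|v vN [c Cc <-]] := UK u; first by split.
apply: negint_le vN; rewrite /cone_le opprB addrCA subrr addr0 //.
Qed.

End cone_interior.

Section convex_combinations.
Context {R : realType}.

Definition weights n (l : 'I_n -> R) := (forall i, 0 <= l i) /\ \sum_i l i = 1.

(** Presents a combination as a point of the segment from the first point to a combination of the
    others, the form in which induction and segment-density apply. *)
Definition cons_weights n (t : R) (m : 'I_n -> R) (i : 'I_n.+1) : R :=
  if unlift ord0 i is Some j then t * m j else 1 - t.

Lemma cons_weights_sum (E : lmodType R) n t (m : 'I_n -> R) (y : 'I_n.+1 -> E) :
  \sum_i cons_weights t m i *: y i =
  (1 - t) *: y ord0 + t *: \sum_i m i *: y (lift ord0 i).
Proof.
rewrite big_ord_recl /cons_weights unlift_none scaler_sumr; congr (_ + _).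
by apply: eq_bigr => i _; rewrite liftK scalerA.
Qed.

Lemma cons_weightsP n t (m : 'I_n -> R) : 0 <= t -> t <= 1 -> weights m ->
  weights (cons_weights t m).
Proof.
move=> t0 t1 [m0 m1]; split.
  move=> i; rewrite /cons_weights; case: unliftP => [j _|_].
    exact: mulr_ge0.
  by rewrite subr_ge0.
have := cons_weights_sum t m (fun=> 1 : R^o).
under eq_bigr do rewrite [_ *: _]mulr1; move=> ->.
under eq_bigr do rewrite [_ *: _]mulr1.
by rewrite m1 [_ *: _]mulr1 [_ *: _]mulr1 subrK.
Qed.

Lemma weights_consE n (l : 'I_n.+2 -> R) : weights l ->
  exists t m, [/\ 0 <= t, t <= 1, weights m & l = cons_weights t m].
Proof.
move=> [l0 l1]; have := l1; rewrite big_ord_recl => l1'.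
set s := \sum_(i < n.+1) _ in l1'.
have s0 : 0 <= s by exact: sumr_ge0.
have sE : s = 1 - l ord0 by rewrite -l1' addrC addKr.
have sle : s <= 1 by rewrite sE gerBl.
have [s_eq0|s_neq0] := eqVneq s 0.
  (* A tail of weight zero cannot be normalised; any weights on it serve, here the unit mass at
     [ord0]. *)
  exists 0, (fun i => (i == ord0)%:R); split=> //.
    split=> [i|]; first exact: ler0n.
    by rewrite (bigD1 ord0)//= big1 ?addr0// => i /negPf->.
  apply/funext => i; rewrite /cons_weights; case: unliftP => [j ->|->].
    rewrite mul0r; apply/eqP; have /eqP := s_eq0.
    by rewrite psumr_eq0// => /allP/(_ j); rewrite mem_index_enum; apply.
  by move: sE; rewrite s_eq0; lra.
exists s, (fun i => l (lift ord0 i) / s); split=> //.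
  split=> [i|]; first by apply: divr_ge0.
  by rewrite -mulr_suml divff.
apply/funext => i; rewrite /cons_weights; case: unliftP => [j ->|->].
  by rewrite mulrC divfK.
by rewrite sE; lra.
Qed.

Lemma convex_set_sum (E : lmodType R) (K : set E) n (l : 'I_n.+1 -> R)
    (y : 'I_n.+1 -> E) :
  convex_set K -> weights l -> (forall i, K (y i)) -> K (\sum_i l i *: y i).
Proof.
move=> /convex_setP cK; elim: n l y => [|n IH] l y wl Ky.
  by rewrite big_ord1; have := wl.2; rewrite big_ord1 => ->; rewrite scale1r.
have [t [m [t0 t1 wm ->]]] := weights_consE wl.
rewrite cons_weights_sum addrC -[X in _ + X *: _]/(1 - t).
by apply: cK => //; exact: IH.
Qed.

End convex_combinations.

(** * Weak approximation of convex combinations within [D] *)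

Section density.
Context {R : realType} (X : normedModType R).

Lemma weak_continuous_affine (a : X) (t : R) :
  continuous ((fun w => a + t *: w) : weak X -> weak X).
Proof.
move=> w.
apply/(weak_cvg_funP _ _ (@nbhs_filter (weak X) w)) => phi.
have phiE (u : X) : phi a + t *: (phi u : R^o) = phi (a + t *: u).
  by rewrite linearD linearZ.
have phi_cvg : phi a + t *: (phi u : R^o) @[u --> nbhs (w : weak X)] -->
    phi a + t *: (phi w : R^o).
  by apply: cvgD; [exact: cvg_cst|apply: cvgZr; exact: weak_continuous_dual].
rewrite -phiE; move: phi_cvg.
have -> : (fun u : weak X => phi a + t *: (phi u : R^o)) =
    (fun u => phi (a + t *: u)).
  by apply/funext => u; exact: phiE.
exact.
Qed.

(** Induction on the number of points: the combination of the tail is moved to a point [v] of [D],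
    then one moves along the segment from [y ord0] to [v], in which [D] is dense. Keeping zero
    weights at zero ensures that only points active in the given combination are used. *)
Lemma self_segment_dense_comb (D K : set X) n (y : 'I_n.+1 -> X)
    (l : 'I_n.+1 -> R) (U : set X) :
  self_segment_dense (weak X) D K -> (forall i, D (y i)) -> weights l ->
  nbhs (\sum_i l i *: y i : weak X) U ->
  exists m, [/\ weights m, forall i, l i = 0 -> m i = 0,
    D (\sum_i m i *: y i) & U (\sum_i m i *: y i)].
Proof.
move=> [_ _ sD]; elim: n y l U => [|n IH] y l U Dy wl nU.
  exists l; split=> //; last exact: (nbhs_singleton nU).
  by rewrite big_ord1; have := wl.2; rewrite big_ord1 => ->; rewrite scale1r.
have [t [m [t0 t1 wm lE]]] := weights_consE wl.
move: nU; rewrite lE cons_weights_sum => nU.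
set g := fun w : weak X => (1 - t) *: y ord0 + t *: w.
(* Working with the interior of [U] keeps [U] a neighbourhood of the intermediate point, which is
   moved once more. *)
have := @weak_continuous_affine ((1 - t) *: y ord0) t _ _ (nbhs_interior nU).
move=> /(IH _ _ _ (fun i => Dy (lift ord0 i)) wm)[m' [wm' mm' Dm' /= Um']].
set v := \sum_i m' i *: y (lift ord0 i) in Dm' Um'.
have [s [s01 s_t0 s_t1 Ds Us]] : exists s, [/\ 0 <= s <= 1, t = 0 -> s = 0,
    t = 1 -> s = 1, D ((1 - s) *: y ord0 + s *: v)
    & U ((1 - s) *: y ord0 + s *: v)].
  (* At the endpoints [s] must equal [t] for zero weights to stay zero; the point is then [y ord0]
     or [v], already in [D]. *)
  have [t_0|t_neq0] := eqVneq t 0.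
    exists 0; rewrite lexx ler01 subr0 scale1r scale0r addr0.
    split=> //; first by rewrite t_0 => /esym/eqP; rewrite oner_eq0.
    by move: (nbhs_singleton Um'); rewrite t_0 subr0 scale1r scale0r addr0.
  have [t_1|t_neq1] := eqVneq t 1.
    exists 1; rewrite ler01 lexx subrr scale0r scale1r add0r.
    split=> //; first by rewrite t_1 => /eqP; rewrite oner_eq0.
    by move: (nbhs_singleton Um'); rewrite t_1 subrr scale1r scale0r add0r.
  have seg (s : R) : y ord0 + s *: (v - y ord0) = (1 - s) *: y ord0 + s *: v.
    by rewrite scalerBr scalerBl scale1r addrA addrAC.
  have : @segment R (weak X) (y ord0) v ((1 - t) *: y ord0 + t *: v).
    by exists t; [rewrite /= in_itv/= t0|exact: seg].
  move=> /(sD _ _ (Dy ord0) Dm') /(_ _ Um')[_ [[[s s01 <-] Ds] Us]].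
  exists s; rewrite -seg; split=> // t_eq; first by rewrite t_eq eqxx in t_neq0.
  by rewrite t_eq eqxx in t_neq1.
exists (cons_weights s m'); rewrite cons_weights_sum; split=> //.
  by case/andP: s01 => *; exact: cons_weightsP.
move=> i; rewrite /cons_weights; case: unliftP => [j _|_] /eqP.
  rewrite mulf_eq0 => /orP[/eqP/s_t0->|/eqP/mm'->]; by rewrite ?mul0r ?mulr0.
by rewrite subr_eq0 => /eqP/esym/s_t1 ->; rewrite subrr.
Qed.

End density.

(** * Solutions on a ball, and the coercivity argument *)

Section kkm.
Context {R : realType} (X : normedModType R).

(** Meant for [a] of total [N.+1]; the successor keeps the denominator nonzero. *)
Definition bary n (y : 'I_n.+1 -> X) (N : nat) (a : 'I_n.+1 -> nat) : X :=
  \sum_j ((a j)%:R / N.+1%:R) *: y j.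

Lemma bary_dist n (y : 'I_n.+1 -> X) (N : nat) (a b : 'I_n.+1 -> nat) :
  (forall j, (a j <= b j + n.+1)%N) -> (forall j, (b j <= a j + n.+1)%N) ->
  `|bary y N a - bary y N b| <= n.+1%:R / N.+1%:R * \sum_j `|y j|.
Proof.
move=> ab ba; rewrite /bary -sumrB mulr_sumr.
apply: le_trans (ler_norm_sum _ _ _) _; apply: ler_sum => j _.
rewrite -scalerBl normrZ -mulrBl normrM [`|_^-1|]ger0_norm ?invr_ge0//.
apply: ler_wpM2r => //; apply: ler_wpM2r; first by rewrite invr_ge0.
rewrite ler_norml; apply/andP; split; first rewrite lerNl opprB.
  by rewrite lerBlDr -natrD ler_nat addnC.
by rewrite lerBlDr -natrD ler_nat addnC.
Qed.

(** For every [N], [grid_kkm] gives one point in each [G i], at mutual distances of order [1 / N]. A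
    weak limit of one of these sequences along an ultrafilter is therefore a limit of them all. *)
Lemma kkm_finite n (y : 'I_n.+1 -> X) (G : 'I_n.+1 -> set X) (K : set X) :
  compact (K : set (weak X)) ->
  (forall i, closed (G i : set (weak X))) -> (forall i, G i `<=` K) ->
  (forall l, weights l -> exists2 i, 0 < l i & G i (\sum_i l i *: y i)) ->
  exists z, forall i, G i z.
Proof.
move=> cK clG GK cover.
have /choice[s sP] : forall N, exists s : 'I_n.+1 -> 'I_n.+1 -> nat,
    (forall i, G i (bary y N (s i))) /\
    forall i i' j, (s i j <= s i' j + n.+1)%N.
  move=> N.
  have [|s [_ sG sD]] :=
    @grid_kkm 'I_n.+1 ord0 N.+1 (fun i a => G i (bary y N a)).
    move=> a aN; have [|i li Gi] := cover (fun j => (a j)%:R / N.+1%:R).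
      split=> [j|]; first by apply: divr_ge0.
      by rewrite -mulr_suml -natr_sum aN divff.
    by exists i => //; move: li; rewrite pmulr_lgt0 ?invr_gt0// ltr0n.
  by exists s; split=> // i i' j; have := sD i i' j; rewrite card_ord.
have [U [UU infU]] := ultraFilterLemma eventually_filter.
have [|z Kz zP] :=
  @ultra_compact_cvg _ (weak X) U (fun N => bary y N (s N ord0)) _ UU cK.
  by apply: infU; exists 0%N => // N _; exact: GK ((sP N).1 _).
exists z => i.
have dist0 :
    (fun N => n.+1%:R / N.+1%:R * \sum_j `|y j| : R^o) @ \oo --> (0 : R^o).
  rewrite -[X in _ --> X](mul0r (\sum_j `|y j|)).
  apply: cvgM; last exact: cvg_cst.
  rewrite -[X in _ --> X](mulr0 n.+1%:R); apply: cvgM; first exact: cvg_cst.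
  exact: cvg_harmonic.
have Ui : bary y N (s N i) @[N --> U] --> (z : weak X).
  apply/weak_cvg_funP => phi.
  have U0 : phi (bary y N (s N ord0)) @[N --> U] --> (phi z : R^o).
    exact: (@weak_cvg_funP _ _ _ _ _ _ _).1.
  have Udiff : (phi (bary y N (s N i)) - phi (bary y N (s N ord0)) : R^o)
      @[N --> U] --> (0 : R^o).
    apply/cvgr0Pnorm_lt => e e0.
    (* The added [1] keeps the divisor positive when [phi] is zero. *)
    have e1 : 0 < e / (`|phi| + 1) by rewrite divr_gt0// ltr_wpDl.
    apply: infU; move/cvgr0Pnorm_lt/(_ _ e1) : dist0; apply: filterS => N small.
    rewrite /= -linearB; apply: le_lt_trans (dual_norm_bound phi _) _.
    apply: (@le_lt_trans _ _
      ((`|phi| + 1) * (n.+1%:R / N.+1%:R * \sum_j `|y j|))).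
      apply: ler_pM => //; first exact: dual_norm_ge0.
        by rewrite lerDl.
      by apply: bary_dist => j; exact: (sP N).2.
    rewrite -ltr_pdivlMl ?ltr_wpDl// [ltRHS]mulrC.
    exact: le_lt_trans (ler_norm _) small.
  rewrite -[X in _ --> X]add0r; apply: cvg_trans (cvgD Udiff U0).
  by apply: near_eq_cvg; apply: nearW => N /=; rewrite subrK.
have /= := @closed_cvg _ (weak X) U _ (fun N => bary y N (s N i))
  _ (clG i) _ z Ui.
apply; apply: nearW => N; exact: (sP N).1.
Qed.

End kkm.

Section main.
Context {R : realType} (X : normedModType R) (Z : tvsType R).
Variables (C : set Z) (K D : set X) (f : X -> X -> Z) (r : R).
Hypotheses (Ccone : cone C) (Cconvex : cone_convex C).
Hypotheses (Xreflexive : reflexive_space X).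
Hypotheses (Kconvex : convex_set K) (Kclosed : closed K).
Hypothesis DK : self_segment_dense (weak X) D K.
Hypothesis f_usc1 : forall y, D y ->
  cone_usc_on (weak X) C K K (fun x => f x y).
Hypothesis f_convex : forall x, K x -> cone_convex_fun C D (fun y => f x y).
Hypothesis f_diag : forall x, D x -> ~ (-%R @` C^°) (f x x).

Let Kr := K `&` [set x | `|x| <= r].
Let G y := Kr `&` [set x | ~ (-%R @` C^°) (f x y)].

Let Kr_convex : convex_set Kr.
Proof.
apply/convex_setP => x y t [Kx /= xr] [Ky /= yr] t0 t1; split.
  exact: (convex_setP K).1.
rewrite /=; apply: le_trans (ler_normD _ _) _.
have t1' : 0 <= 1 - t by rewrite subr_ge0.
rewrite !normrZ !ger0_norm//.
have := ler_wpM2l t0 xr; have := ler_wpM2l t1' yr; lra.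
Qed.

Let Kr_closed : closed Kr.
Proof.
apply: closedI => //.
rewrite (_ : [set _ | _] = (fun x : X => `|x|) @^-1` [set t | t <= r])//.
apply: preimage_closed; last exact: closed_le.
by move=> x _; exact: norm_continuous.
Qed.

Let Kr_compact : compact (Kr : set (weak X)).
Proof.
by apply: (weakly_compact_bounded_convex (r := r)) Xreflexive _ _ _ => // x [].
Qed.

Lemma solution_set_closed y : D y -> closed (G y : set (weak X)).
Proof.
move=> Dy x Gx.
have Kx : Kr x.
  apply: (weakly_closed_convex Kr_closed Kr_convex).
  by apply: closure_subset Gx => u [].
split=> // fxy.
have /Gx[u [[[Ku _] nfu] /(_ Ku)]] :=
  cone_usc_negint Cconvex (f_usc1 Dy Kx.1) fxy.
exact: nfu.
Qed.

Lemma solution_set_cover n (y : 'I_n.+1 -> X) (l : 'I_n.+1 -> R) :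
  (forall i, D (y i)) -> (forall i, `|y i| <= r) -> weights l ->
  exists2 i, 0 < l i & G (y i) (\sum_i l i *: y i).
Proof.
move=> Dy yr wl; have [DsubK _ _] := DK; set p := \sum_i _.
have Krp : Kr p.
  by apply: convex_set_sum => // i; split; [exact: DsubK|exact: yr].
apply: contrapT => noi.
have fneg i : 0 < l i -> (-%R @` C^°) (f p (y i)).
  by move=> li; apply: contrapT => nf; apply: noi; exists i.
(* There are finitely many conditions, and by semicontinuity in the first argument each persists,
   within [K], on a weak neighbourhood of [p]. *)
have near_neg : \forall u \near (p : weak X),
    forall i, 0 < l i -> K u -> (-%R @` C^°) (f u (y i)).
  apply: (@filter_forall _ _ _ _ (@nbhs_filter (weak X) p)) => i.
  have [/fneg fi|_] := ltP 0 (l i); last exact: nearW.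
  have := cone_usc_negint Cconvex (f_usc1 (Dy i) Krp.1) fi.
  by apply: (@filterS _ _ (@nbhs_filter (weak X) p)) => u Uu _.
have [m [wm lm Du Uu]] := self_segment_dense_comb DK Dy wl near_neg.
have Ku := DsubK _ Du.
apply: (f_diag Du); apply: (negint_le Cconvex).
  by apply: (f_convex Ku _ wm.1 wm.2 Du).
apply: (negint_sum Ccone Cconvex wm.1 wm.2) => i mi; apply: Uu => //.
(* A positive [m i] forces a positive [l i], zero weights having been preserved. *)
rewrite lt_neqAle wl.1 andbT eq_sym.
by apply: contraTneq mi => /lm ->; rewrite ltxx.
Qed.

(** Finite intersection property in the weakly compact [Kr], with [kkm_finite] for the finite
    subfamilies. The given point of [D] is what places the common point in [Kr]. *)
Lemma solution_on_ball : (exists2 y, D y & `|y| <= r) ->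
  exists2 x, Kr x & forall y, D y -> `|y| <= r -> ~ (-%R @` C^°) (f x y).
Proof.
move=> [y0 Dy0 y0r]; pose Dr := D `&` [set y | `|y| <= r].
have := Kr_compact; rewrite compact_In0.
move=> /(_ X Dr (G : X -> set (weak X)))[|D' D'sub|x xG].
- exists (G : X -> set (weak X)) => [y [Dy _]|y _].
    exact: solution_set_closed.
  by rewrite /G setIA setIid.
(* The empty subfamily is treated apart, as [kkm_finite] takes at least one point. *)
- have [D'0|] := eqVneq (size (finmap.enum_fset D')) 0%N.
    exists 0 => y /= yD'; move: D'0 => /size0nil D'0.
    by rewrite -[_ \in _]/(y \in finmap.enum_fset D') D'0 in yD'.
  case sE : (size _) => [//|n] _.
  pose y (i : 'I_n.+1) := nth 0 (finmap.enum_fset D') i.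
  have yDr i : Dr (y i) by apply/set_mem/D'sub/mem_nth; rewrite sE.
  have [|||z Gz] := @kkm_finite _ X n y (fun i => G (y i)) Kr Kr_compact.
  + by move=> i; apply: solution_set_closed; case: (yDr i).
  + by move=> i x [].
  + by move=> l; apply: solution_set_cover => i; case: (yDr i).
  exists z => x /= xD'.
  have xs : (index x (finmap.enum_fset D') < n.+1)%N by rewrite -sE index_mem.
  by have := Gz (Ordinal xs); rewrite /y /= nth_index.
have [Krx _] := xG y0 (conj Dy0 y0r); exists x => // y Dy yr.
by have [] := xG y (conj Dy yr).
Qed.

End main.

(** A functional separating [a] from [b] is affine and increasing in the parameter of the segment,
    so a weakly open slab isolates the parameters strictly between [0] and [d]. *)
Lemma self_segment_dense_near (R : realType) (X : normedModType R)
    (D K : set X) (a b : X) (d : R) :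
  self_segment_dense (weak X) D K -> D a -> D b -> a != b -> 0 < d ->
  exists t, [/\ 0 < t, t <= 1, t < d & D ((1 - t) *: a + t *: b)].
Proof.
move=> [_ _ sD] Da Db ab d0.
have [|||phi [e [e0 /(_ b erefl) phib]]] :=
  @closed_convex_separation _ X [set b] a.
- exact/accessible_closed_set1/hausdorff_accessible/norm_hausdorff.
- exact: convex_set1.
- by move=> /= /eqP; rewrite (negPf ab).
pose w := phi b - phi a.
have w0 : 0 < w by rewrite /w; lra.
have seg (t : R) : a + t *: (b - a) = (1 - t) *: a + t *: b.
  by rewrite scalerBr scalerBl scale1r addrA addrAC.
have phiE t : phi (a + t *: (b - a)) = phi a + t * w.
  by rewrite linearD linearZ linearB.
(* The two halves put [t1] in [[0, 1]] and strictly below [d], so that its point lies both on the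
   segment and in the slab. *)
pose t1 := Num.min (1 / 2) (d / 2).
have t10 : 0 < t1 by rewrite lt_min !divr_gt0.
have : @segment R (weak X) a b (a + t1 *: (b - a)).
  exists t1 => //; rewrite /= in_itv/= ltW//= ge_min; apply/orP; left; lra.
pose I := [set s | s \in `]phi a, phi a + d * w[].
move=> /(sD _ _ Da Db)/(_ (phi @^-1` I))[].
  apply: (@weak_continuous_dual _ _ phi (a + t1 *: (b - a))); rewrite phiE.
  apply: near_in_itvoo; rewrite in_itv/= ltrDl mulr_gt0//=.
  by rewrite ltrD2l ltr_pM2r// gt_min; apply/orP; right; lra.
move=> _ [[[t + <-] Dt] /=].
rewrite /I/= !in_itv/= phiE ltrDl ltrD2l ltr_pM2r// pmulr_lgt0//.
by move=> /andP[_ t_le1] /andP[t_gt0 td]; exists t; split=> //; rewrite -seg.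
Qed.

Lemma cone_convex_fun2 (R : realType) (Z E : lmodType R) (C : set Z) (D : set E)
    (g : E -> Z) (a b : E) (t : R) :
  cone_convex_fun C D g -> D a -> D b -> 0 <= t -> t <= 1 ->
  D ((1 - t) *: a + t *: b) ->
  cone_le C (g ((1 - t) *: a + t *: b)) ((1 - t) *: g a + t *: g b).
Proof.
move=> gconv Da Db t0 t1 Dt.
have w1 : weights (fun _ : 'I_1 => 1 : R) by split=> //; rewrite big_ord1.
have [l0 l1] := cons_weightsP t0 t1 w1.
pose y (i : 'I_2) := if i == ord0 then a else b.
have comb (F : lmodType R) (h : E -> F) :
    \sum_i cons_weights t (fun=> 1) i *: h (y i) = (1 - t) *: h a + t *: h b.
  by rewrite cons_weights_sum big_ord1 scale1r.
have := gconv 2%N y _ _ l0 l1; rewrite (comb _ id) (comb _ g); apply=> // i.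
by rewrite /y; case: ifP.
Qed.

Theorem theorem3p7 (R : realType) (X : completeNormedModType R)
  (Xreflexive : reflexive_space X)
  (Z : tvsType R) (Zhausdorff : hausdorff_space Z)
  (C : set Z) (Ccone : cone C) (Cconvex : cone_convex C)
  (Cpointed : cone_pointed C) (Cint : C^° !=set0)
  (K : set X) (K0 : K !=set0) (Kconvex : convex_set K) (Kclosed : closed K)
  (D : set X)
  (DK : self_segment_dense (weak X) D K)
  (f : X -> X -> Z)
  (f_usc1 : forall y, D y ->
    cone_usc_on (weak X) C K K (fun x => f x y))
  (f_usc2 : forall x, K x ->
    cone_usc_on (weak X) C K (K `\` D) (fun y => f x y))
  (f_convex : forall x, K x -> cone_convex_fun C D (fun y => f x y))
  (f_diag : forall x, D x -> ~ (-%R @` C^°) (f x x))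
  (* the closed ball of radius r is required to meet K *)
  (f_coercive : exists r : R, [/\ 0 < r, exists2 x, K x & `|x| <= r &
    forall x, K x -> `|x| <= r ->
      exists y0, [/\ D y0, `|y0| < r &
        ((-%R @` C^°) `|` [set 0]) (f x y0)]]) :
  exists2 x0, K x0 & forall y, K y -> ~ (-%R @` C^°) (f x0 y).
Proof.
have [r [r0 [x1 Kx1 x1r] coercive]] := f_coercive.
have [|x0 [Kx0 x0r] x0D] :=
  @solution_on_ball _ X Z C K D f r Ccone Cconvex Xreflexive Kconvex Kclosed DK
    f_usc1 f_convex f_diag.
  by have [y0 [Dy0 /ltW y0r _]] := coercive x1 Kx1 x1r; exists y0.
have {}x0D y : D y -> ~ (-%R @` C^°) (f x0 y).
  move=> Dy fy; have [y0 [Dy0 y0r fy0]] := coercive x0 Kx0 x0r.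
  have {}fy0 : f x0 y0 = 0.
    by case: fy0 => // /x0D; case=> //; exact: ltW.
  have [yy0|yy0] := eqVneq y0 y.
    by apply: (x0D y); rewrite -?yy0 ?ltW// yy0.
  (* Since [y0] is strictly inside the ball, a parameter below this bound keeps [y0 + t *: (y - y0)]
     in the ball. *)
  have d0 : 0 < (r - `|y0|) / `|y - y0|.
    by rewrite divr_gt0 ?subr_gt0// normr_gt0 subr_eq0 eq_sym.
  have [t [t0 t1 td Dt]] := self_segment_dense_near DK Dy0 Dy yy0 d0.
  apply: (x0D _ Dt).
    have -> : (1 - t) *: y0 + t *: y = y0 + t *: (y - y0).
      by rewrite scalerBr scalerBl scale1r addrA addrAC.
    apply: le_trans (ler_normD _ _) _; rewrite normrZ gtr0_norm//.
    rewrite -lerBrDl -ler_pdivlMr ?ltW//.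
    by rewrite normr_gt0 subr_eq0 eq_sym.
  have := cone_convex_fun2 (f_convex _ Kx0) Dy0 Dy (ltW t0) t1 Dt.
  move=> /(negint_le Cconvex); apply.
  (* As [f x0 y0 = 0], the convexity bound is [t *: f x0 y] with [t] positive, hence in
     [- int C]. *)
  by rewrite fy0 scaler0 add0r; exact: (negintZ Ccone).
exists x0 => // y Ky fy; have [Dy|nDy] := pselect (D y); first exact: x0D fy.
have [DsubK Ddense _] := DK.
have near_neg := cone_usc_negint Cconvex (f_usc2 _ Kx0 _ (conj Ky nDy)) fy.
have [u [Du Uu]] := Ddense y Ky _ near_neg.
exact: x0D Du (Uu (DsubK _ Du)).
Qed.
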